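(* Let $g:\mathbb{R}\to\mathbb{R}$ be smooth and periodic, let $\mu\in\mathbb{R}$ be such that $1+\mu g(y)>0$ for all $y\in\mathbb{R}$, and let $\phi\in C_0^\infty(\mathbb{R})$. For each $\epsilon>0$ let $u^\epsilon$ be the (bounded) classical solution of $$u^\epsilon_t=[1+\mu g(\epsilon^{-1}x)]\,u^\epsilon_{xx},\quad x\in\mathbb{R},\ t\ge0,\qquad u^\epsilon(x,0)=\phi(x).$$ Let $u^0$ be the (bounded) classical solution of $$u^0_t=\sigma u^0_{xx},\qquad u^0(\cdot,0)=\phi,$$ where $\sigma=\big\langle[1+\mu g(y)]^{-1}\big\rangle^{-1}$. Then $$\sup_{x\in\mathbb{R}}|u^\epsilon(x,t)-u^0(x,t)|\longrightarrow0\ \text{ as }\epsilon\to0,\qquad\text{for all }t\ge0.$$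
   Context: For a periodic function $h:\mathbb{R}\to\mathbb{R}$ of period $l$, $\langle h\rangle=\frac1l\int_0^l h(y)\,dy$ denotes its mean over a period. $C_0^\infty(\mathbb{R})$ is the set of infinitely differentiable real functions with compact support. A bounded classical solution means a solution with the derivatives occurring in the equation existing classically for $t>0$, continuous on $\mathbb{R}\times[0,\infty)$, and bounded on $\mathbb{R}\times[0,T]$ for every $T>0$. *)

(* Defs.v *)
From Stdlib Require Import Reals.
From Coquelicot Require Import Coquelicot.
Open Scope R_scope.

Definition periodic (l : R) (h : R -> R) : Prop :=
  forall y, h (y + l) = h y.

Definition mean (l : R) (h : R -> R) : R := / l * RInt h 0 l.

(* [ex_derive_n h n x] alone only says that the total function
   [Derive_n h (n - 1)] is differentiable at [x]; quantifying over all [n] and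
   [x] makes every derivative a genuine one. *)
Definition smooth (h : R -> R) : Prop :=
  forall (n : nat) (x : R), ex_derive_n h n x.

Definition compactly_supported (h : R -> R) : Prop :=
  Rtopology.compact (Rtopology.adherence (fun x => h x <> 0)).

(* [u x t] is a bounded classical solution of [u_t = a(x) u_xx] with
   [u(x, 0) = phi x]. [Derive] is total, so the existence of [u_t], [u_x] and
   [u_xx] for [t > 0] is required separately; no continuity of these
   derivatives is assumed. *)
Record bounded_classical_solution (a phi : R -> R) (u : R -> R -> R) : Prop := {
  bcs_continuous :
    continuous_on (fun p : R * R => 0 <= snd p)
                  (fun p : R * R => u (fst p) (snd p));
  bcs_bounded :
    forall T, 0 < T ->
      exists M, forall x t, 0 <= t <= T -> Rabs (u x t) <= M;
  bcs_initial : forall x, u x 0 = phi x;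
  bcs_ex_dt : forall x t, 0 < t -> ex_derive (fun s => u x s) t;
  bcs_ex_dx : forall x t, 0 < t -> ex_derive (fun y => u y t) x;
  bcs_ex_dxx : forall x t, 0 < t -> ex_derive_n (fun y => u y t) 2 x;
  bcs_equation :
    forall x t, 0 < t ->
      Derive (fun s => u x s) t = a x * Derive_n (fun y => u y t) 2 x
}.

(* Main.v *)
Require Import Defs.
From Stdlib Require Import Reals Factorial Lra Lia ClassicalEpsilon.
From Coquelicot Require Import Coquelicot.
Open Scope R_scope.

(** Write [a = 1 + mu g]. The harmonic mean [sigma] is exactly the constant for
    which the cell problem [a (1 + X'') = sigma] has a periodic solution [X]
    (lemma [corrector]): [sigma / a - 1] is periodic with mean zero. If [v] is a
    smooth solution of the homogenized equation, the two-scale ansatz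
    [w = v + eps^2 X (x / eps) v_xx] satisfies
    [w_t - a (x / eps) w_xx = O(eps)], because the terms of order one cancel by
    the cell problem. The maximum principle on the line
    ([weak_maximum_principle], [approximate_solution_error]) then gives
    [|u^eps - w| = O(eps)].

    The ansatz requires bounds on [v_xxx], [v_xxxx] and [v_xxt], and nothing of
    the kind is known a priori about [u0]. So [v] is not [u0] but an approximate
    solution with an explicit formula. The heat semigroup is replaced by that of
    a continuous-time random walk of small step [h], whose Poisson series is cut
    after [N] terms ([walk]): a finite sum of products of functions of [t] and
    averaged translates of [phi]. It commutes with [d/dx] and does not increase
    the sup norm, so its spatial derivatives are bounded by those of [phi]
    uniformly in [h] and [N]; hence, for [h] small and then [N] large, its defect
    in [v_t = sigma v_xx] is at most any prescribed [eta] ([walk_defect]). With [h] and [N] fixed, the remaining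
    terms of the ansatz vanish as [eps] tends to [0] ([two_scale_error]). The
    same estimate with zero corrector compares [u0] with [v], so both [u^eps]
    and [u0] are within [eta t + O(eps)] of [v], and [eta] is arbitrary. *)

(** * Extrema on compact rectangles *)

(** The closed rectangle of the [(x, y)] with [a <= x <= b] and [c <= y <= d]. *)
Definition rectangle (a b c d : R) (p : R * R) : Prop :=
  a <= fst p <= b /\ c <= snd p <= d.

(** The gauge in the compactness argument is the modulus of continuity cut off
    by [1 / (1 + |f|)], so that a positive lower bound for the gauge also bounds
    [f] at the centres of the covering. *)
Lemma continuous_rectangle_bounded_above (f : R * R -> R) (a b c d : R) :
  continuous_on (rectangle a b c d) f ->
  exists B, forall p, rectangle a b c d p -> f p <= B.
Proof.
  intros Hf.
  assert (Hg : forall x y, exists e : posreal,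
    e <= / (1 + Rabs (f (x, y))) /\
    (rectangle a b c d (x, y) ->
     forall p, rectangle a b c d p -> Rabs (fst p - x) < e ->
       Rabs (snd p - y) < e -> f p <= f (x, y) + 1)).
  { intros x y.
    assert (Hi : 0 < / (1 + Rabs (f (x, y)))).
    { apply Rinv_0_lt_compat. pose proof (Rabs_pos (f (x, y))). lra. }
    destruct (excluded_middle_informative (rectangle a b c d (x, y))) as [Hr | Hr].
    - pose proof (proj1 (filterlim_locally _ _) (Hf _ Hr) (mkposreal 1 Rlt_0_1)) as [e He].
      exists (mkposreal (Rmin e (/ (1 + Rabs (f (x, y)))))
               (Rmin_stable_in_posreal e (mkposreal _ Hi))). simpl.
      split; [apply Rmin_r |].
      intros _ p Hp H1 H2.
      assert (Hb : ball (f (x, y)) 1 (f p)).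
      { apply (He p); [| exact Hp].
        split; simpl.
        - apply Rlt_le_trans with (1 := H1), Rmin_l.
        - apply Rlt_le_trans with (1 := H2), Rmin_l. }
      change (Rabs (f p - f (x, y)) < 1) in Hb.
      apply Rabs_def2 in Hb. lra.
    - exists (mkposreal _ Hi). simpl. split; [lra | tauto]. }
  pose (gauge x y := proj1_sig (constructive_indefinite_description _ (Hg x y))).
  destruct (compactness_value_2d a b c d gauge) as [e He].
  exists (/ e + 1). intros [x y] [Hx Hy]. simpl in Hx, Hy.
  apply Rnot_lt_le. intros Hlt. apply (He x y Hx Hy).
  intros (u & v & Hu & Hv & H1 & H2 & H3).
  unfold gauge in H1, H2, H3.
  destruct (constructive_indefinite_description _ (Hg u v)) as [e' [He1 He2]].
  simpl in H1, H2, H3.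
  specialize (He2 (conj Hu Hv) (x, y) (conj Hx Hy) H1 H2).
  assert (Hf1 : f (u, v) <= / e).
  { pose proof (Rle_abs (f (u, v))). pose proof (Rabs_pos (f (u, v))).
    pose proof (cond_pos e).
    assert (1 + Rabs (f (u, v)) <= / e).
    { rewrite <- (Rinv_inv (1 + Rabs (f (u, v)))).
      apply Rinv_le_contravar; lra. }
    lra. }
  lra.
Qed.

(** Extreme value theorem on a rectangle: were the supremum [M] not attained,
    [1 / (M - f)] would be continuous and unbounded. *)
Lemma continuous_rectangle_max (f : R * R -> R) (a b c d : R) :
  a <= b -> c <= d -> continuous_on (rectangle a b c d) f ->
  exists p, rectangle a b c d p /\ forall q, rectangle a b c d q -> f q <= f p.
Proof.
  intros Hab Hcd Hf.
  destruct (continuous_rectangle_bounded_above f a b c d Hf) as [B HB].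
  destruct (completeness (fun r => exists p, rectangle a b c d p /\ r = f p))
    as [M [HM1 HM2]].
  { exists B. intros r (p & Hp & ->). now apply HB. }
  { exists (f (a, c)), (a, c). unfold rectangle; simpl. repeat split; lra. }
  apply NNPP. intros Hno.
  assert (Hlt : forall p, rectangle a b c d p -> f p < M).
  { intros p Hp. destruct (Rle_lt_or_eq_dec (f p) M) as [H | H]; trivial.
    - apply HM1. now exists p.
    - exfalso. apply Hno. exists p. split; trivial.
      intros q Hq. rewrite H. apply HM1. now exists q. }
  destruct (continuous_rectangle_bounded_above (fun p => / (M - f p)) a b c d) as [C HC].
  { intros p Hp.
    apply (filterlim_comp _ _ _ f (fun r => / (M - r)) _ (locally (f p))).
    - now apply Hf.
    - apply continuous_Rinv_comp.
      + apply (continuous_minus (fun _ : R => M) (fun r : R => r));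
          [apply continuous_const | apply continuous_id].
      + specialize (Hlt p Hp). lra. }
  assert (HCp : 0 < C).
  { assert (Hr : rectangle a b c d (a, c)) by (unfold rectangle; simpl; lra).
    specialize (HC _ Hr). specialize (Hlt _ Hr).
    assert (0 < / (M - f (a, c))) by (apply Rinv_0_lt_compat; lra). lra. }
  assert (H : M <= M - / C).
  { apply HM2. intros r (p & Hp & ->).
    specialize (HC p Hp). specialize (Hlt p Hp).
    assert (/ C <= M - f p).
    { rewrite <- (Rinv_inv (M - f p)). apply Rinv_le_contravar; trivial.
      apply Rinv_0_lt_compat. lra. }
    lra. }
  pose proof (Rinv_0_lt_compat C HCp). lra.
Qed.

(** * Joint continuity *)

Lemma continuous_on_minus {U : UniformSpace} (D : U -> Prop) (f g : U -> R) :
  continuous_on D f -> (forall p, continuous g p) ->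
  continuous_on D (fun p => f p - g p).
Proof.
  intros Hf Hg p Hp.
  apply (filterlim_comp_2 (G := locally (f p)) (H := locally (- g p)) f (fun q => - g q) Rplus).
  - now apply Hf.
  - eapply filterlim_filter_le_1.
    + exact (filter_le_within D).
    + apply (continuous_opp (V := R_NormedModule) g p), Hg.
  - apply (filterlim_plus (V := R_NormedModule)).
Qed.

Lemma continuous_fst_comp (f : R -> R) (p : R * R) :
  continuous f (fst p) -> continuous (fun q : R * R => f (fst q)) p.
Proof.
  destruct p as [x y]. intros H. apply (continuous_comp fst f); trivial.
  apply continuous_fst.
Qed.

Lemma continuous_snd_comp (f : R -> R) (p : R * R) :
  continuous f (snd p) -> continuous (fun q : R * R => f (snd q)) p.
Proof.
  destruct p as [x y]. intros H. apply (continuous_comp snd f); trivial.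
  apply continuous_snd.
Qed.

Lemma continuous_Rplus {U : UniformSpace} (f g : U -> R) (p : U) :
  continuous f p -> continuous g p -> continuous (fun q => f q + g q) p.
Proof. exact (continuous_plus (V := R_NormedModule) f g p). Qed.

Lemma continuous_Rmult {U : UniformSpace} (f g : U -> R) (p : U) :
  continuous f p -> continuous g p -> continuous (fun q => f q * g q) p.
Proof. exact (continuous_mult (K := R_AbsRing) f g p). Qed.

Ltac continuity_on_plane :=
  repeat first
    [ apply continuous_const
    | apply (continuous_fst_comp (fun x => x)); apply continuous_id
    | apply (continuous_snd_comp (fun x => x)); apply continuous_id
    | apply continuous_Rplus
    | apply continuous_Rmult ].

(** * The maximum principle *)

Lemma derive_nonneg_at_left_max (f : R -> R) (t r l : R) :
  0 < r -> (forall s, t - r <= s <= t -> f s <= f t) ->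
  is_derive f t l -> 0 <= l.
Proof.
  intros Hr Hmax Hd. apply is_derive_Reals in Hd.
  apply Rnot_lt_le. intros Hl.
  destruct (Hd (- l)) as [e He]; [lra |]. pose proof (cond_pos e).
  pose (k := Rmin e r / 2).
  assert (Hk : 0 < k /\ k < e /\ k <= r).
  { unfold k. pose proof (Rmin_l e r). pose proof (Rmin_r e r).
    assert (0 < Rmin e r) by (apply Rmin_glb_lt; lra). lra. }
  specialize (He (- k)). rewrite Rabs_Ropp, (Rabs_pos_eq k) in He by lra.
  specialize (He ltac:(lra) ltac:(lra)).
  apply Rabs_def2 in He.
  specialize (Hmax (t + - k) ltac:(lra)).
  assert (0 <= (f (t + - k) - f t) / - k).
  { replace ((f (t + - k) - f t) / - k) with ((f t - f (t + - k)) / k)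
      by (field; lra).
    apply Rmult_le_pos; [lra | left; apply Rinv_0_lt_compat; lra]. }
  lra.
Qed.

Lemma second_derive_nonpos_at_max (f f1 : R -> R) (x r l : R) :
  0 < r -> (forall y, x - r <= y <= x + r -> f y <= f x) ->
  (forall y, is_derive f y (f1 y)) -> is_derive f1 x l -> l <= 0.
Proof.
  intros Hr Hmax Hf Hd. apply is_derive_Reals in Hd.
  apply Rnot_lt_le. intros Hl.
  destruct (Hd l) as [e He]; [lra |]. pose proof (cond_pos e).
  pose (k := Rmin e r / 2).
  assert (Hk : 0 < k /\ k < e /\ k <= r).
  { unfold k. pose proof (Rmin_l e r). pose proof (Rmin_r e r).
    assert (0 < Rmin e r) by (apply Rmin_glb_lt; lra). lra. }
  (* [f1] lies strictly above [f1 x] just to the right of [x], and strictly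
     below it just to the left. *)
  assert (Hq : forall h, h <> 0 -> Rabs h < e -> 0 < (f1 (x + h) - f1 x) / h).
  { intros h Hh1 Hh2. specialize (He h Hh1 Hh2). apply Rabs_def2 in He. lra. }
  assert (Hlim : forall c, derivable_pt_lim f c (f1 c)).
  { intros c. apply is_derive_Reals, Hf. }
  destruct (Rle_lt_dec 0 (f1 x)) as [H0 | H0].
  - destruct (MVT_cor2 f f1 x (x + k)) as (c & Hc1 & Hc2); [lra | auto |].
    specialize (Hmax (x + k) ltac:(lra)).
    specialize (Hq (c - x) ltac:(lra) ltac:(rewrite Rabs_pos_eq; lra)).
    replace (x + (c - x)) with c in Hq by ring.
    assert (H1 : 0 < (f1 c - f1 x) / (c - x) * (c - x))
      by (apply Rmult_lt_0_compat; lra).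
    replace ((f1 c - f1 x) / (c - x) * (c - x)) with (f1 c - f1 x) in H1
      by (field; lra).
    nra.
  - destruct (MVT_cor2 f f1 (x - k) x) as (c & Hc1 & Hc2); [lra | auto |].
    specialize (Hmax (x - k) ltac:(lra)).
    specialize (Hq (c - x) ltac:(lra) ltac:(rewrite Rabs_left; lra)).
    replace (x + (c - x)) with c in Hq by ring.
    assert (H1 : 0 < (f1 c - f1 x) / (c - x) * (x - c))
      by (apply Rmult_lt_0_compat; lra).
    replace ((f1 c - f1 x) / (c - x) * (x - c)) with (f1 x - f1 c) in H1
      by (field; lra).
    nra.
Qed.

(** The points [(x, t)] with [t >= 0]. *)
Definition upper_half_plane (p : R * R) : Prop := 0 <= snd p.

(** Weak maximum principle on the line for functions bounded above: the barrier
    [k (x^2 + (2 A + 1) t)] is a strict supersolution that dominates at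
    infinity, so the maximum of the perturbed function on a large rectangle can
    only be nonpositive; then [k] tends to [0]. *)
Lemma weak_maximum_principle (a : R -> R) (A T B eta : R)
    (z zt z1 z2 : R -> R -> R) :
  0 < T ->
  (forall x, 0 <= a x <= A) ->
  continuous_on upper_half_plane (fun p => z (fst p) (snd p)) ->
  (forall x t, 0 <= t <= T -> z x t <= B) ->
  (forall x, z x 0 <= 0) ->
  (forall x t, 0 < t <= T -> is_derive (fun s => z x s) t (zt x t)) ->
  (forall x t, 0 < t <= T -> is_derive (fun y => z y t) x (z1 x t)) ->
  (forall x t, 0 < t <= T -> is_derive (fun y => z1 y t) x (z2 x t)) ->
  (forall x t, 0 < t <= T -> zt x t <= a x * z2 x t + eta) ->
  forall x t, 0 <= t <= T -> z x t <= eta * t.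
Proof.
  intros HT Ha Hc HB H0 Ht H1 H2 Heq x t Hxt.
  assert (HA : 0 <= A) by (specialize (Ha 0); lra).
  assert (Hk : forall k, 0 < k -> z x t <= eta * t + k * (x ^ 2 + (2 * A + 1) * t)).
  { intros k Hk.
    (* On the sides [x = L] and [x = - L] the barrier exceeds [B + |eta| T]. *)
    pose (L := Rabs x + 1 + (Rabs B + Rabs eta * T) / k).
    pose proof (Rabs_pos B) as HB0. pose proof (Rabs_pos eta) as He0.
    pose proof (Rabs_pos x) as Hx0. pose proof (Rle_abs B) as HBa.
    assert (Hq : 0 <= (Rabs B + Rabs eta * T) / k).
    { apply Rmult_le_pos; [nra | left; apply Rinv_0_lt_compat; lra]. }
    assert (HL1 : 1 <= L) by (unfold L; lra).
    assert (HL2 : k + (Rabs B + Rabs eta * T) <= k * L).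
    { unfold L.
      replace (k * (Rabs x + 1 + (Rabs B + Rabs eta * T) / k))
        with (k * Rabs x + k + (Rabs B + Rabs eta * T)) by (field; lra).
      nra. }
    pose (Z := fun p : R * R => z (fst p) (snd p) - eta * snd p
                 - k * (fst p ^ 2 + (2 * A + 1) * snd p)).
    destruct (continuous_rectangle_max Z (- L) L 0 T) as ([x0 t0] & Hr & Hmax).
    { lra. } { lra. }
    { unfold Z. apply (continuous_on_ext (rectangle (- L) L 0 T) (fun p => z (fst p) (snd p) -
               (eta * snd p + k * (fst p ^ 2 + (2 * A + 1) * snd p)))).
      { intros [y s] _. cbn [fst snd]. apply Rminus_diag_uniq. ring. }
      apply continuous_on_minus.
      - apply continuous_on_subset with (2 := Hc). intros q Hq'.
        unfold upper_half_plane. apply Hq'.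
      - intros q. simpl. continuity_on_plane. }
    destruct Hr as [Hr1 Hr2]; simpl in Hr1, Hr2.
    assert (HZ : Z (x0, t0) <= 0).
    { apply Rnot_lt_le. intros Hpos.
      assert (Ht0 : 0 < t0).
      { destruct (Req_dec t0 0) as [E | E]; [| lra].
        subst t0. unfold Z in Hpos; simpl in Hpos.
        specialize (H0 x0). nra. }
      assert (HxL : x0 <> L /\ x0 <> - L).
      { assert (Hx2 : x0 ^ 2 <> L ^ 2).
        { intros E. unfold Z in Hpos. cbn [fst snd] in Hpos. rewrite E in Hpos.
          specialize (HB x0 t0 ltac:(lra)).
          pose proof (Rle_abs (- eta)) as Hea. rewrite Rabs_Ropp in Hea.
          assert (- eta * t0 <= Rabs eta * T) by nra.
          assert (k * L <= k * L ^ 2) by (apply Rmult_le_compat_l; nra).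
          assert (0 <= k * ((2 * A + 1) * t0)) by
            (apply Rmult_le_pos; [lra |]; apply Rmult_le_pos; lra).
          lra. }
        split; intros ->; apply Hx2; ring. }
      pose (r := Rmin (L - x0) (x0 + L)).
      assert (Hr : 0 < r) by (unfold r; apply Rmin_glb_lt; lra).
      assert (Hra : r <= L - x0) by apply Rmin_l.
      assert (Hrb : r <= x0 + L) by apply Rmin_r.
      assert (Hdt : 0 <= zt x0 t0 - eta - k * (2 * A + 1)).
      { apply (derive_nonneg_at_left_max (fun s => Z (x0, s)) t0 t0); trivial.
        - intros s Hs. apply Hmax. unfold rectangle; simpl; lra.
        - unfold Z; simpl. auto_derive.
          + exists (zt x0 t0). apply Ht; lra.
          + rewrite (is_derive_unique (fun s : R => z x0 s) _ _ (Ht x0 t0 ltac:(lra))). ring. }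
      assert (Hdx : z2 x0 t0 - 2 * k <= 0).
      { apply (second_derive_nonpos_at_max (fun y => Z (y, t0))
                 (fun y => z1 y t0 - k * (2 * y)) x0 r); trivial.
        - intros y Hy. apply Hmax. unfold rectangle; simpl; lra.
        - intros y. unfold Z; simpl. auto_derive.
          + exists (z1 y t0). apply H1; lra.
          + rewrite (is_derive_unique (fun y : R => z y t0) _ _ (H1 y t0 ltac:(lra))). ring.
        - auto_derive.
          + exists (z2 x0 t0). apply H2; lra.
          + rewrite (is_derive_unique (fun y : R => z1 y t0) _ _ (H2 x0 t0 ltac:(lra))). ring. }
      specialize (Heq x0 t0 ltac:(lra)). specialize (Ha x0).
      assert (a x0 * z2 x0 t0 <= a x0 * (2 * k)) by (apply Rmult_le_compat_l; lra).
      assert (a x0 * (2 * k) <= A * (2 * k)) by (apply Rmult_le_compat_r; lra).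
      lra. }
    assert (HZx : Z (x, t) <= 0).
    { apply Rle_trans with (2 := HZ). apply Hmax.
      unfold rectangle; simpl. split; [| lra].
      assert (Rabs x <= L) by (unfold L; lra).
      now apply Rabs_le_between. }
    unfold Z in HZx; simpl in HZx. simpl. lra. }
  apply le_epsilon. intros e He.
  pose (C := x ^ 2 + (2 * A + 1) * t).
  assert (HC : 0 <= C).
  { unfold C. pose proof (pow2_ge_0 x).
    assert (0 <= (2 * A + 1) * t) by (apply Rmult_le_pos; lra). lra. }
  specialize (Hk (e / (C + 1)) ltac:(apply Rdiv_lt_0_compat; lra)).
  fold C in Hk.
  assert (e / (C + 1) * C <= e).
  { apply Rmult_le_reg_r with (C + 1); [lra |].
    replace (e / (C + 1) * C * (C + 1)) with (e * C) by (field; lra). nra. }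
  lra.
Qed.

(** An approximate solution [w], with initial error [delta] and defect [eta] in
    the equation, is within [delta + eta t] of the exact one. *)
Lemma approximate_solution_error (a phi : R -> R) (u w wt w1 w2 : R -> R -> R)
    (A T B delta eta : R) :
  0 < T ->
  (forall x, 0 <= a x <= A) ->
  bounded_classical_solution a phi u ->
  (forall p, continuous (fun p : R * R => w (fst p) (snd p)) p) ->
  (forall x t, 0 <= t <= T -> Rabs (w x t) <= B) ->
  (forall x, Rabs (phi x - w x 0) <= delta) ->
  (forall x t, 0 < t <= T -> is_derive (fun s => w x s) t (wt x t)) ->
  (forall x t, 0 < t <= T -> is_derive (fun y => w y t) x (w1 x t)) ->
  (forall x t, 0 < t <= T -> is_derive (fun y => w1 y t) x (w2 x t)) ->
  (forall x t, 0 < t <= T -> Rabs (wt x t - a x * w2 x t) <= eta) ->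
  forall x t, 0 <= t <= T -> Rabs (u x t - w x t) <= delta + eta * t.
Proof.
  intros HT Ha [uc ub ui ut ux uxx ue] Hwc HwB Hi Ht H1 H2 He.
  destruct (ub T HT) as [M HM].
  (* [u - w] and [w - u] are handled together, through a sign [s]. *)
  assert (Hs : forall s, s = 1 \/ s = -1 -> forall x t, 0 <= t <= T ->
            s * u x t - (s * w x t + delta) <= eta * t).
  { intros s Hs.
    apply (weak_maximum_principle a A T (M + B - delta) eta
      (fun x t => s * u x t - (s * w x t + delta))
      (fun x t => s * Derive (fun r => u x r) t - s * wt x t)
      (fun x t => s * Derive (fun y => u y t) x - s * w1 x t)
      (fun x t => s * Derive_n (fun y => u y t) 2 x - s * w2 x t)); trivial.
    - apply (continuous_on_minus upper_half_plane
               (fun p : R * R => s * u (fst p) (snd p))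
               (fun p : R * R => s * w (fst p) (snd p) + delta)).
      + intros p Hp.
        apply (filterlim_comp _ _ _ (fun p : R * R => u (fst p) (snd p))
                 (fun r => s * r) _ (locally (u (fst p) (snd p)))).
        * now apply uc.
        * apply (continuous_scal_r (K := R_AbsRing) (V := R_NormedModule) s (fun r => r)).
          apply continuous_id.
      + intros p. apply continuous_Rplus; [| apply continuous_const].
        apply continuous_Rmult; [apply continuous_const | apply Hwc].
    - intros x t Hxt. specialize (HM x t Hxt). specialize (HwB x t Hxt).
      apply Rabs_le_between in HM. apply Rabs_le_between in HwB.
      destruct Hs; subst s; lra.
    - intros x. rewrite ui. specialize (Hi x). apply Rabs_le_between in Hi.
      destruct Hs; subst s; lra.
    - intros x t Hxt. specialize (Ht x t Hxt). auto_derive.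
      + split; [apply ut; lra |]. split; [| easy]. now exists (wt x t).
      + rewrite (is_derive_unique (fun r : R => w x r) _ _ Ht). ring.
    - intros x t Hxt. specialize (H1 x t Hxt). auto_derive.
      + split; [apply ux; lra |]. split; [| easy]. now exists (w1 x t).
      + rewrite (is_derive_unique (fun y : R => w y t) _ _ H1). ring.
    - intros x t Hxt. specialize (H2 x t Hxt).
      pose proof (uxx x t ltac:(lra)) as Hxx. simpl in Hxx. simpl.
      auto_derive.
      + split; [exact Hxx |]. split; [| easy]. now exists (w2 x t).
      + rewrite (is_derive_unique (fun y : R => w1 y t) _ _ H2). ring.
    - intros x t Hxt. rewrite ue by lra. specialize (He x t Hxt).
      apply Rabs_le_between in He.
      destruct Hs; subst s; lra. }
  intros x t Hxt.
  pose proof (Hs 1 ltac:(now left) x t Hxt).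
  pose proof (Hs (-1) ltac:(now right) x t Hxt).
  apply Rabs_le. lra.
Qed.

(** * Approximate solutions of the heat equation *)

(** The random-walk operator with step [h]; [avg h - 1] is [h^2 / 2] times the
    discrete Laplacian. *)
Definition avg (h : R) (f : R -> R) (x : R) : R := (f (x + h) + f (x - h)) / 2.

(** The probability of [n] jumps up to time [t] of a Poisson process of rate
    [lam]. *)
Definition poisson (lam : R) (n : nat) (t : R) : R :=
  exp (- (lam * t)) * ((lam * t) ^ n / INR (fact n)).

(** The semigroup [exp (lam t (avg h - 1)) f], written as an expectation over a
    Poisson number of steps and truncated after [N] of them. *)
Definition walk (lam h : R) (N : nat) (f : R -> R) (x t : R) : R :=
  sum_f_R0 (fun n => poisson lam n t * Nat.iter n (avg h) f x) N.

(** Time derivative of [walk]; the last term comes from the truncation. *)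
Definition walk_dt (lam h : R) (N : nat) (f : R -> R) (x t : R) : R :=
  lam * (avg h (fun y => walk lam h N f y t) x - walk lam h N f x t)
  - lam * poisson lam N t * Nat.iter (S N) (avg h) f x.

Lemma iter_avg_bound (h C : R) (f : R -> R) (n : nat) :
  (forall x, Rabs (f x) <= C) -> forall x, Rabs (Nat.iter n (avg h) f x) <= C.
Proof.
  intros Hf. induction n as [| n IH]; intros x; simpl; trivial.
  unfold avg at 1. pose proof (IH (x + h)) as Ha. pose proof (IH (x - h)) as Hb.
  apply Rabs_le_between in Ha. apply Rabs_le_between in Hb. apply Rabs_le. lra.
Qed.

Lemma is_derive_iter_avg (h : R) (f f1 : R -> R) (n : nat) :
  (forall x, is_derive f x (f1 x)) ->
  forall x, is_derive (Nat.iter n (avg h) f) x (Nat.iter n (avg h) f1 x).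
Proof.
  intros Hf. induction n as [| n IH]; intros x; simpl; trivial.
  unfold avg at 1 3.
  auto_derive.
  - split; [eexists; apply IH |]. split; [eexists; apply IH | easy].
  - rewrite (is_derive_unique (fun y : R => Nat.iter n (avg h) f y) _ _ (IH (x + h))).
    rewrite (is_derive_unique (fun y : R => Nat.iter n (avg h) f y) _ _ (IH (x + - h))).
    unfold Rminus. field.
Qed.

Lemma poisson_nonneg (lam t : R) (n : nat) : 0 <= lam * t -> 0 <= poisson lam n t.
Proof.
  intros H. unfold poisson. apply Rmult_le_pos; [left; apply exp_pos |].
  apply Rmult_le_pos; [now apply pow_le |].
  left. apply Rinv_0_lt_compat, INR_fact_lt_0.
Qed.

Lemma poisson_sum_le_1 (lam t : R) (N : nat) :
  0 <= lam * t -> sum_f_R0 (fun n => poisson lam n t) N <= 1.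
Proof.
  intros H.
  apply Rle_trans with
    (exp (- (lam * t)) * sum_f_R0 (fun n => (lam * t) ^ n / INR (fact n)) N).
  { right. rewrite scal_sum. apply sum_eq. intros n _. unfold poisson. ring. }
  replace 1 with (exp (- (lam * t)) * exp (lam * t))
    by (rewrite <- exp_plus, <- exp_0; f_equal; ring).
  apply Rmult_le_compat_l; [left; apply exp_pos |].
  now apply exp_ge_taylor.
Qed.

Lemma poisson_le_1 (lam t : R) (n : nat) : 0 <= lam * t -> poisson lam n t <= 1.
Proof.
  intros H. destruct n as [| n].
  - apply (poisson_sum_le_1 lam t 0 H).
  - pose proof (poisson_sum_le_1 lam t (S n) H) as Hs. simpl in Hs.
    assert (0 <= sum_f_R0 (fun n => poisson lam n t) n).
    { apply cond_pos_sum. intros k. now apply poisson_nonneg. }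
    lra.
Qed.

Lemma is_derive_poisson_0 (lam t : R) :
  is_derive (poisson lam 0) t (- lam * poisson lam 0 t).
Proof. unfold poisson. simpl. auto_derive; [easy | field]. Qed.

Lemma is_derive_poisson_S (lam t : R) (n : nat) :
  is_derive (poisson lam (S n)) t (lam * (poisson lam n t - poisson lam (S n) t)).
Proof.
  assert (Hk : INR (fact (S n)) = INR (S n) * INR (fact n))
    by (rewrite fact_simpl; apply mult_INR).
  pose proof (INR_fact_neq_0 n). pose proof (not_0_INR (S n) ltac:(lia)).
  unfold poisson. rewrite Hk. auto_derive; [easy |].
  change (match n with O => 1 | S _ => INR n + 1 end) with (INR (S n)).
  simpl pow. field. split; trivial.
Qed.

(** The tail vanishes uniformly on bounded time intervals. *)
Lemma poisson_tail (lam T e : R) :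
  0 <= lam -> 0 < e -> exists N, forall t, 0 <= t <= T -> poisson lam N t <= e.
Proof.
  intros Hl He. destruct (cv_speed_pow_fact (lam * T) e He) as [N HN].
  exists N. intros t Ht. specialize (HN N (le_n N)).
  unfold Rdist in HN. rewrite Rminus_0_r in HN. apply Rabs_def2 in HN.
  apply Rle_trans with ((lam * T) ^ N / INR (fact N)); [| lra].
  assert (Hlt : 0 <= lam * t) by (apply Rmult_le_pos; lra).
  assert (Hf : 0 < / INR (fact N)) by apply Rinv_0_lt_compat, INR_fact_lt_0.
  apply Rle_trans with (1 * ((lam * t) ^ N / INR (fact N))).
  - unfold poisson. apply Rmult_le_compat_r.
    + apply Rmult_le_pos; [now apply pow_le | lra].
    + rewrite <- exp_0. destruct Hlt as [Hlt | <-].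
      * left. apply exp_increasing. lra.
      * right. f_equal. ring.
  - rewrite Rmult_1_l. apply Rmult_le_compat_r; [lra |].
    apply pow_incr. split; trivial. apply Rmult_le_compat_l; lra.
Qed.

Lemma walk_bound (lam h C : R) (N : nat) (f : R -> R) (x t : R) :
  0 <= lam * t -> (forall x, Rabs (f x) <= C) -> Rabs (walk lam h N f x t) <= C.
Proof.
  intros Hlt Hf.
  assert (HC : 0 <= C) by (apply Rle_trans with (2 := Hf 0), Rabs_pos).
  unfold walk. apply Rle_trans with (1 := Rsum_abs _ _).
  apply Rle_trans with (C * sum_f_R0 (fun n => poisson lam n t) N).
  - rewrite scal_sum. apply sum_Rle. intros n _.
    rewrite Rabs_mult, (Rabs_pos_eq (poisson lam n t)) by now apply poisson_nonneg.
    apply Rmult_le_compat_l; [now apply poisson_nonneg | now apply iter_avg_bound].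
  - pose proof (poisson_sum_le_1 lam t N Hlt). nra.
Qed.

Lemma walk_initial (lam h : R) (N : nat) (f : R -> R) (x : R) :
  walk lam h N f x 0 = f x.
Proof.
  unfold walk. induction N as [| N IH].
  - simpl. unfold poisson. rewrite Rmult_0_r, Ropp_0, exp_0. simpl. field.
  - rewrite tech5, IH. unfold poisson. rewrite Rmult_0_r, pow_i by lia.
    unfold Rdiv. ring.
Qed.

Lemma is_derive_walk_x (lam h : R) (N : nat) (f f1 : R -> R) :
  (forall x, is_derive f x (f1 x)) ->
  forall x t, is_derive (fun y => walk lam h N f y t) x (walk lam h N f1 x t).
Proof.
  intros Hf x t. unfold walk.
  assert (Hn : forall n, is_derive (fun y => poisson lam n t * Nat.iter n (avg h) f y) x
                 (poisson lam n t * Nat.iter n (avg h) f1 x)).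
  { intros n. apply (is_derive_scal (Nat.iter n (avg h) f)).
    now apply is_derive_iter_avg. }
  induction N as [| N IH]; [apply Hn |].
  cbn [sum_f_R0]. now apply (is_derive_plus (V := R_NormedModule)).
Qed.

Lemma avg_walk (lam h : R) (N : nat) (f : R -> R) (x t : R) :
  avg h (fun y => walk lam h N f y t) x
  = sum_f_R0 (fun n => poisson lam n t * Nat.iter (S n) (avg h) f x) N.
Proof.
  assert (lin : forall (c : R) (F G : R -> R),
            avg h (fun y => F y + c * G y) x = avg h F x + c * avg h G x).
  { intros c F G. unfold avg. field. }
  unfold walk. induction N as [| N IH].
  - simpl. unfold avg. field.
  - rewrite tech5, <- IH. apply lin.
Qed.

Lemma is_derive_walk_t (lam h : R) (N : nat) (f : R -> R) (x t : R) :
  is_derive (fun s => walk lam h N f x s) t (walk_dt lam h N f x t).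
Proof.
  unfold walk_dt. rewrite avg_walk. unfold walk.
  induction N as [| N IH].
  - cbn [sum_f_R0].
    replace (lam * _ - _) with (- lam * poisson lam 0 t * f x) by (simpl; ring).
    apply (is_derive_scal_l (V := R_NormedModule) (poisson lam 0)).
    apply is_derive_poisson_0.
  - cbn [sum_f_R0].
    pose proof (is_derive_scal_l (V := R_NormedModule) (poisson lam (S N)) t _
      (Nat.iter (S N) (avg h) f x) (is_derive_poisson_S lam t N)) as HS.
    pose proof (is_derive_plus (V := R_NormedModule) _ _ _ _ _ IH HS) as Hd.
    eapply (eq_rect _ (is_derive _ t) Hd).
    unfold plus, scal; simpl. unfold mult; simpl. ring.
Qed.

Lemma continuous_walk (lam h : R) (N : nat) (f : R -> R) :
  (forall x, continuous f x) ->
  forall p, continuous (fun p : R * R => walk lam h N f (fst p) (snd p)) p.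
Proof.
  intros Hf p. unfold walk.
  assert (Hi : forall n x, continuous (Nat.iter n (avg h) f) x).
  { induction n as [| n IH]; intros x; simpl; trivial.
    unfold avg at 1. unfold Rdiv.
    apply continuous_Rmult; [| apply continuous_const].
    apply continuous_Rplus.
    - apply (continuous_comp (fun y => y + h) (Nat.iter n (avg h) f)); trivial.
      apply continuous_Rplus; [apply continuous_id | apply continuous_const].
    - apply (continuous_comp (fun y => y - h) (Nat.iter n (avg h) f)); trivial.
      apply continuous_Rplus; [apply continuous_id | apply continuous_const]. }
  assert (Hn : forall n, continuous
     (fun p : R * R => poisson lam n (snd p) * Nat.iter n (avg h) f (fst p)) p).
  { intros n. apply continuous_Rmult.
    - apply (continuous_snd_comp (poisson lam n)).
      apply (ex_derive_continuous (K := R_AbsRing) (V := R_NormedModule)).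
      destruct n; eexists; [apply is_derive_poisson_0 | apply is_derive_poisson_S].
    - now apply (continuous_fst_comp (Nat.iter n (avg h) f)). }
  induction N as [| N IH]; [apply Hn |].
  cbn [sum_f_R0]. now apply continuous_Rplus.
Qed.

(** The bound on [f3] is passed to [f2], [f1] and [f] in turn by the mean value
    theorem; the constant is not optimal. *)
Lemma second_difference_error (f f1 f2 f3 : R -> R) (C x h : R) :
  (forall x, is_derive f x (f1 x)) ->
  (forall x, is_derive f1 x (f2 x)) ->
  (forall x, is_derive f2 x (f3 x)) ->
  (forall x, Rabs (f3 x) <= C) -> 0 < h ->
  Rabs (f (x + h) + f (x - h) - 2 * f x - h ^ 2 * f2 x) <= 2 * C * h ^ 3.
Proof.
  intros H0 H1 H2 H3 Hh.
  assert (HC : 0 <= C) by (apply Rle_trans with (2 := H3 0), Rabs_pos).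
  assert (lim : forall g g1 : R -> R, (forall x, is_derive g x (g1 x)) ->
            forall c, derivable_pt_lim g c (g1 c)).
  { intros g g1 Hg c. apply is_derive_Reals, Hg. }
  assert (E2 : forall s, 0 < s -> Rabs (f2 (x + s) + f2 (x - s) - 2 * f2 x) <= 2 * C * s).
  { intros s Hs.
    destruct (MVT_cor2 f2 f3 x (x + s)) as (c & Hc & _); [lra | auto |].
    destruct (MVT_cor2 f2 f3 (x - s) x) as (d & Hd & _); [lra | auto |].
    pose proof (H3 c) as Bc. pose proof (H3 d) as Bd.
    apply Rabs_le_between in Bc. apply Rabs_le_between in Bd.
    apply Rabs_le. nra. }
  assert (E1 : forall s, 0 < s ->
            Rabs (f1 (x + s) - f1 (x - s) - 2 * s * f2 x) <= 2 * C * s ^ 2).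
  { intros s Hs.
    destruct (MVT_cor2 (fun s => f1 (x + s) - f1 (x - s) - 2 * s * f2 x)
      (fun s => f2 (x + s) + f2 (x - s) - 2 * f2 x) 0 s) as (c & Hc & Hc'); trivial.
    { intros c _. apply is_derive_Reals.
      auto_derive.
      - repeat split; eexists; apply H1.
      - rewrite !(is_derive_unique (fun y : R => f1 y) _ _ (H1 _)).
        unfold Rminus; ring. }
    rewrite Rplus_0_r, Rminus_0_r in Hc.
    specialize (E2 c ltac:(lra)). apply Rabs_le_between in E2.
    assert (2 * C * c <= 2 * C * s) by nra.
    apply Rabs_le. simpl. nra. }
  destruct (MVT_cor2 (fun s => f (x + s) + f (x - s) - 2 * f x - s ^ 2 * f2 x)
      (fun s => f1 (x + s) - f1 (x - s) - 2 * s * f2 x) 0 h) as (c & Hc & Hc'); trivial.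
  { intros c _. apply is_derive_Reals.
    auto_derive.
    - repeat split; eexists; apply H0.
    - rewrite !(is_derive_unique (fun y : R => f y) _ _ (H0 _)).
      unfold Rminus; ring. }
  rewrite Rplus_0_r, Rminus_0_r in Hc.
  specialize (E1 c ltac:(lra)). apply Rabs_le_between in E1.
  assert (2 * C * c ^ 2 <= 2 * C * h ^ 2).
  { apply Rmult_le_compat_l; [lra |]. apply pow_incr. lra. }
  apply Rabs_le. simpl in *. nra.
Qed.

(** For a small step and a late truncation, [walk] solves the heat equation up
    to any prescribed defect. The rate [2 sigma / h^2] is the diffusive
    scaling, and the consistency error is controlled uniformly in [h] because
    [walk] commutes with [d/dx] and does not increase the sup norm. *)
Lemma walk_defect (sigma T eta C : R) (f f1 f2 f3 : R -> R) :
  0 < sigma -> 0 < eta ->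
  (forall x, is_derive f x (f1 x)) ->
  (forall x, is_derive f1 x (f2 x)) ->
  (forall x, is_derive f2 x (f3 x)) ->
  (forall x, Rabs (f x) <= C) ->
  (forall x, Rabs (f3 x) <= C) ->
  exists lam h N, 0 <= lam /\ forall x t, 0 <= t <= T ->
    Rabs (walk_dt lam h N f x t - sigma * walk lam h N f2 x t) <= eta.
Proof.
  intros Hs He H0 H1 H2 B0 B3.
  assert (HC : 0 <= C) by (apply Rle_trans with (2 := B0 0), Rabs_pos).
  pose (h := eta / (4 * sigma * (C + 1))).
  assert (Hsc : 0 < 4 * sigma * (C + 1)) by nra.
  assert (Hh : 0 < h) by now apply Rdiv_lt_0_compat.
  pose (lam := 2 * sigma / h ^ 2).
  assert (Hh2 : 0 < h ^ 2) by now apply pow_lt.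
  assert (Hl : 0 < lam) by (apply Rdiv_lt_0_compat; lra).
  assert (Hlc : 0 < lam * (C + 1)) by nra.
  destruct (poisson_tail lam T (eta / (2 * (lam * (C + 1))))) as [N HN]; [lra | |].
  { apply Rdiv_lt_0_compat; lra. }
  exists lam, h, N. split; [lra |]. intros x t Ht.
  assert (Hlt : 0 <= lam * t) by nra.
  pose (v := fun y => walk lam h N f y t).
  pose (v2 := fun y => walk lam h N f2 y t).
  assert (Hv : Rabs (v (x + h) + v (x - h) - 2 * v x - h ^ 2 * v2 x) <= 2 * C * h ^ 3).
  { apply second_difference_error with
      (f1 := fun y => walk lam h N f1 y t) (f3 := fun y => walk lam h N f3 y t); trivial;
      unfold v, v2; intros y.
    1-3: now apply is_derive_walk_x.
    now apply walk_bound. }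
  assert (Hp : Rabs (lam * poisson lam N t * Nat.iter (S N) (avg h) f x) <= eta / 2).
  { pose proof (poisson_nonneg lam t N Hlt) as P0. specialize (HN t Ht).
    rewrite !Rabs_mult, (Rabs_pos_eq lam), (Rabs_pos_eq (poisson lam N t)) by lra.
    pose proof (iter_avg_bound h C f (S N) B0 x) as Bi.
    apply Rle_trans with (lam * (eta / (2 * (lam * (C + 1)))) * (C + 1)).
    - apply Rmult_le_compat; [| apply Rabs_pos | | lra].
      + apply Rmult_le_pos; lra.
      + apply Rmult_le_compat_l; lra.
    - right. field. lra. }
  assert (Hm : walk_dt lam h N f x t - sigma * walk lam h N f2 x t
    = sigma / h ^ 2 * (v (x + h) + v (x - h) - 2 * v x - h ^ 2 * v2 x)
      - lam * poisson lam N t * Nat.iter (S N) (avg h) f x).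
  { assert (E : lam * ((v (x + h) + v (x - h)) / 2 - v x) - sigma * v2 x
                = sigma / h ^ 2 * (v (x + h) + v (x - h) - 2 * v x - h ^ 2 * v2 x))
      by (unfold lam; field; lra).
    rewrite <- E.
    change (walk_dt lam h N f x t) with
      (lam * ((v (x + h) + v (x - h)) / 2 - v x)
       - lam * poisson lam N t * Nat.iter (S N) (avg h) f x).
    change (walk lam h N f2 x t) with (v2 x). ring. }
  rewrite Hm. apply Rle_trans with (1 := Rabs_triang _ _).
  rewrite Rabs_Ropp, Rabs_mult.
  assert (Hsh : 0 < sigma / h ^ 2) by (apply Rdiv_lt_0_compat; lra).
  rewrite (Rabs_pos_eq (sigma / h ^ 2)) by lra.
  assert (sigma / h ^ 2 * Rabs (v (x + h) + v (x - h) - 2 * v x - h ^ 2 * v2 x)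
          <= eta / 2).
  { apply Rle_trans with (sigma / h ^ 2 * (2 * (C + 1) * h ^ 3)).
    - apply Rmult_le_compat_l; [lra |]. apply Rle_trans with (1 := Hv).
      apply Rmult_le_compat_r; [| lra]. left. now apply pow_lt.
    - replace (sigma / h ^ 2 * (2 * (C + 1) * h ^ 3)) with (2 * sigma * (C + 1) * h)
        by (field; lra).
      right. unfold h. field. lra. }
  lra.
Qed.

Lemma walk_dt_bound (lam h C : R) (N : nat) (f : R -> R) (x t : R) :
  0 <= lam -> 0 <= t -> (forall x, Rabs (f x) <= C) ->
  Rabs (walk_dt lam h N f x t) <= 3 * lam * C.
Proof.
  intros Hl Ht Hf.
  assert (HC : 0 <= C) by (apply Rle_trans with (2 := Hf 0), Rabs_pos).
  assert (Hlt : 0 <= lam * t) by nra.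
  pose proof (fun y => walk_bound lam h C N f y t Hlt Hf) as Bw.
  pose proof (poisson_nonneg lam t N Hlt) as P0.
  pose proof (poisson_le_1 lam t N Hlt) as P1.
  pose proof (iter_avg_bound h C f (S N) Hf x) as Bi.
  unfold walk_dt.
  assert (E1 : Rabs (avg h (fun y => walk lam h N f y t) x - walk lam h N f x t) <= 2 * C).
  { unfold avg. pose proof (Bw (x + h)) as Ba. pose proof (Bw (x - h)) as Bb.
    specialize (Bw x).
    apply Rabs_le_between in Ba, Bb, Bw. apply Rabs_le. lra. }
  assert (E2 : Rabs (poisson lam N t * Nat.iter (S N) (avg h) f x) <= C).
  { rewrite Rabs_mult, (Rabs_pos_eq _ P0).
    pose proof (Rabs_pos (Nat.iter (S N) (avg h) f x)). nra. }
  rewrite Rmult_assoc.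
  apply Rabs_le_between in E1, E2. apply Rabs_le. nra.
Qed.

(** * Periodic functions and the corrector *)

Lemma periodic_IZR (l : R) (h : R -> R) (k : Z) :
  periodic l h -> forall y, h (y + IZR k * l) = h y.
Proof.
  intros Hp.
  induction k as [| k IH | k IH] using Z.peano_ind; intros y.
  - f_equal. ring.
  - rewrite succ_IZR. rewrite <- (IH y), <- (Hp (y + IZR k * l)). f_equal. ring.
  - rewrite <- (IH y), <- (Hp (y + IZR (Z.pred k) * l)).
    rewrite <- Z.sub_1_r, minus_IZR. f_equal. ring.
Qed.

Lemma periodic_bounded (l : R) (h : R -> R) :
  0 < l -> periodic l h -> (forall x, continuous h x) ->
  exists B, forall x, Rabs (h x) <= B.
Proof.
  intros Hl Hp Hc.
  destruct (continuity_ab_maj (fun x => Rabs (h x)) 0 l) as (m & Hm & _); [lra | |].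
  { intros c _. apply continuity_pt_filterlim.
    apply (continuous_comp h Rabs); [apply Hc | apply continuous_Rabs]. }
  exists (Rabs (h m)). intros x.
  destruct (archimed (x / l)) as [Ha Hb].
  (* [up r - 1] is the integer part of [r], so [x + k l] lies in the first period. *)
  pose (k := (1 - up (x / l))%Z).
  rewrite <- (periodic_IZR l h k Hp x). apply Hm.
  assert (E : x + IZR k * l = (x / l + 1 - IZR (up (x / l))) * l).
  { unfold k. rewrite minus_IZR. field. lra. }
  rewrite E. split; [apply Rmult_le_pos; lra |].
  apply Rle_trans with (1 * l); [apply Rmult_le_compat_r; lra | lra].
Qed.

Lemma is_derive_primitive (h : R -> R) :
  (forall x, continuous h x) ->
  forall x, is_derive (fun y => RInt h 0 y) x (h x).
Proof.
  intros Hc x. apply (is_derive_RInt h (fun y => RInt h 0 y) 0 x); trivial.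
  apply filter_forall. intros y. apply (RInt_correct h).
  now apply (ex_RInt_continuous h).
Qed.

Lemma periodic_primitive (l : R) (h : R -> R) :
  periodic l h -> (forall x, continuous h x) -> RInt h 0 l = 0 ->
  periodic l (fun y => RInt h 0 y).
Proof.
  intros Hp Hc H0 y.
  assert (Hex : forall a b, ex_RInt h a b)
    by (intros a b; now apply (ex_RInt_continuous h)).
  (* Cut the integral at [l] and shift the second piece back by a period. *)
  rewrite <- (RInt_Chasles h 0 l (y + l)); trivial.
  rewrite H0. change (0 + RInt h l (y + l) = RInt h 0 y). rewrite Rplus_0_l.
  pose proof (RInt_comp_lin h 1 l 0 y) as E.
  rewrite !Rmult_1_l, Rplus_0_l in E. rewrite <- E by trivial.
  apply RInt_ext. intros s _. unfold scal; simpl; unfold mult; simpl.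
  rewrite !Rmult_1_l. apply Hp.
Qed.

Lemma RInt_minus_mean (l : R) (h : R -> R) :
  0 < l -> (forall x, continuous h x) -> RInt (fun y => h y - mean l h) 0 l = 0.
Proof.
  intros Hl Hc.
  rewrite (RInt_minus (V := R_CompleteNormedModule) h (fun _ => mean l h)).
  - rewrite RInt_const. unfold minus, plus, opp, scal; simpl. unfold mult; simpl.
    unfold mean. field. lra.
  - now apply (ex_RInt_continuous h).
  - apply ex_RInt_const.
Qed.

(** A periodic function of mean zero is the second derivative of a function
    bounded together with its first derivative. *)
Lemma bounded_second_primitive (l : R) (h : R -> R) :
  0 < l -> periodic l h -> (forall x, continuous h x) -> RInt h 0 l = 0 ->
  exists (X X1 : R -> R) (D : R),
    (forall x, is_derive X x (X1 x)) /\ (forall x, is_derive X1 x (h x)) /\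
    (forall x, Rabs (X x) <= D) /\ (forall x, Rabs (X1 x) <= D).
Proof.
  intros Hl Hp Hc H0.
  pose (H := fun y => RInt h 0 y).
  assert (dH : forall x, is_derive H x (h x)) by now apply is_derive_primitive.
  assert (cH : forall x, continuous H x).
  { intros x. apply (ex_derive_continuous (K := R_AbsRing) (V := R_NormedModule)).
    eexists; apply dH. }
  pose (X1 := fun y => H y - mean l H).
  assert (dX1 : forall x, is_derive X1 x (h x)).
  { intros x. unfold X1. specialize (dH x). auto_derive.
    - now exists (h x).
    - rewrite (is_derive_unique (fun y : R => H y) _ _ dH). ring. }
  assert (cX1 : forall x, continuous X1 x).
  { intros x. apply (ex_derive_continuous (K := R_AbsRing) (V := R_NormedModule)).
    eexists; apply dX1. }
  assert (pX1 : periodic l X1).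
  { intros y. unfold X1. f_equal. now apply periodic_primitive. }
  pose (X := fun y => RInt X1 0 y).
  assert (dX : forall x, is_derive X x (X1 x)) by now apply is_derive_primitive.
  assert (pX : periodic l X).
  { apply periodic_primitive; trivial. now apply RInt_minus_mean. }
  destruct (periodic_bounded l X1) as [D1 HD1]; trivial.
  destruct (periodic_bounded l X) as [D0 HD0]; trivial.
  { intros x. apply (ex_derive_continuous (K := R_AbsRing) (V := R_NormedModule)).
    eexists; apply dX. }
  exists X, X1, (Rmax D0 D1). refine (conj dX (conj dX1 (conj _ _))); intros x.
  - apply Rle_trans with (1 := HD0 x), Rmax_l.
  - apply Rle_trans with (1 := HD1 x), Rmax_r.
Qed.

Lemma mean_pos (l : R) (h : R -> R) :
  0 < l -> (forall x, continuous h x) -> (forall x, 0 < h x) -> 0 < mean l h.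
Proof.
  intros Hl Hc Hpos. unfold mean. apply Rmult_lt_0_compat.
  - now apply Rinv_0_lt_compat.
  - apply RInt_gt_0; trivial; intros; trivial.
Qed.

(** The harmonic mean [sigma] is the constant for which the cell problem
    [a (1 + X'') = sigma] has a bounded solution. *)
Lemma corrector (l : R) (a : R -> R) (sigma : R) :
  0 < l -> periodic l a -> (forall x, continuous a x) -> (forall x, 0 < a x) ->
  sigma = / mean l (fun y => / a y) ->
  exists (X X1 : R -> R) (D : R),
    (forall x, is_derive X x (X1 x)) /\
    (forall x, is_derive X1 x (sigma / a x - 1)) /\
    (forall x, Rabs (X x) <= D) /\ (forall x, Rabs (X1 x) <= D).
Proof.
  intros Hl Hp Hc Hpos Hs.
  assert (ci : forall x, continuous (fun y => / a y) x).
  { intros x. apply continuous_Rinv_comp; trivial. specialize (Hpos x). lra. }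
  assert (Hm : 0 < mean l (fun y => / a y)).
  { apply mean_pos; trivial. intros x. now apply Rinv_0_lt_compat. }
  apply (bounded_second_primitive l); trivial.
  - intros y. now rewrite Hp.
  - intros x. apply (continuous_minus (V := R_NormedModule) (fun y => sigma / a y) (fun _ => 1));
      [| apply continuous_const].
    apply continuous_Rmult; [apply continuous_const | apply ci].
  - rewrite (RInt_ext _ (fun y => sigma * (/ a y - mean l (fun y => / a y)))).
    + rewrite (RInt_scal (V := R_CompleteNormedModule) (fun y => / a y - _)).
      * rewrite RInt_minus_mean by trivial. apply Rmult_0_r.
      * apply (ex_RInt_continuous (V := R_CompleteNormedModule)). intros z _.
        apply (continuous_minus (V := R_NormedModule) (fun y => / a y));
          [apply ci | apply continuous_const].
    + intros x _. rewrite Hs. unfold Rdiv. rewrite Rmult_minus_distr_l.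
      rewrite (Rmult_comm _ (mean _ _)), Rinv_r by lra. reflexivity.
Qed.

(** * Derivatives of test functions *)

Lemma smooth_is_derive (f : R -> R) (n : nat) :
  smooth f -> forall x, is_derive (Derive_n f n) x (Derive_n f (S n) x).
Proof. intros Hf x. apply Derive_correct. exact (Hf (S n) x). Qed.

Lemma smooth_continuous (f : R -> R) : smooth f -> forall x, continuous f x.
Proof.
  intros Hf x. apply (ex_derive_continuous (K := R_AbsRing) (V := R_NormedModule)).
  exact (Hf 1%nat x).
Qed.

Lemma test_function_derivative_bounded (f : R -> R) (n : nat) :
  smooth f -> compactly_supported f ->
  exists C, forall x, Rabs (Derive_n f n x) <= C.
Proof.
  intros Hf Hs.
  destruct (compact_P1 _ Hs) as (m & M & HmM).
  assert (Hz : forall x, ~ (m <= x <= M) -> Derive_n f n x = 0).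
  { induction n as [| n IH]; intros x Hx.
    - simpl. apply NNPP. intros H. apply Hx, HmM. now apply adherence_P1.
    - simpl. rewrite (Derive_ext_loc _ (fun _ => 0)); [apply Derive_const |].
      destruct (Rlt_dec x m) as [H | H].
      + apply filter_imp with (2 := open_lt m x H). intros y Hy. apply IH. lra.
      + apply filter_imp with (2 := open_gt M x ltac:(lra)). intros y Hy. apply IH. lra. }
  pose (L := Rabs m + Rabs M).
  pose proof (Rabs_pos m). pose proof (Rabs_pos M).
  destruct (continuity_ab_maj (fun x => Rabs (Derive_n f n x)) (- L) L) as (y & Hy & _).
  { unfold L. lra. }
  { intros c _. apply continuity_pt_filterlim.
    apply (continuous_comp (Derive_n f n) Rabs); [| apply continuous_Rabs].
    apply (ex_derive_continuous (K := R_AbsRing) (V := R_NormedModule)).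
    exact (Hf (S n) c). }
  exists (Rabs (Derive_n f n y)). intros x.
  destruct (Rle_dec (- L) x) as [H1 | H1]; [destruct (Rle_dec x L) as [H2 | H2] |].
  - apply Hy. lra.
  - rewrite Hz; [rewrite Rabs_R0; apply Rabs_pos |].
    unfold L in *. pose proof (Rle_abs M). lra.
  - rewrite Hz; [rewrite Rabs_R0; apply Rabs_pos |].
    unfold L in *. pose proof (Rle_abs (- m)) as Hq. rewrite Rabs_Ropp in Hq. lra.
Qed.

Lemma test_function_derivatives_bounded (f : R -> R) (n : nat) :
  smooth f -> compactly_supported f ->
  exists C, forall k, (k <= n)%nat -> forall x, Rabs (Derive_n f k x) <= C.
Proof.
  intros Hf Hs. induction n as [| n [C HC]].
  - destruct (test_function_derivative_bounded f 0 Hf Hs) as [C HC].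
    exists C. intros k Hk x. replace k with 0%nat by lia. apply HC.
  - destruct (test_function_derivative_bounded f (S n) Hf Hs) as [C' HC'].
    exists (Rmax C C'). intros k Hk x.
    destruct (Nat.eq_dec k (S n)) as [-> | Hne].
    + apply Rle_trans with (1 := HC' x), Rmax_r.
    + apply Rle_trans with (1 := HC k ltac:(lia) x), Rmax_l.
Qed.

(** * Two-scale expansion *)

(** Error of the two-scale ansatz [v + eps^2 X (x / eps) v_xx]. The parameters
    of [walk] are fixed here, so constants depending on them are harmless as
    [eps] tends to [0]; only [eta] measures how far [walk] is from solving the
    homogenized equation. *)
Lemma two_scale_error (a X X1 : R -> R) (sigma A D : R) (phi : R -> R) (C : R)
    (lam h : R) (N : nat) (T eta : R) :
  (forall y, 0 < a y <= A) ->
  (forall y, is_derive X y (X1 y)) ->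
  (forall y, is_derive X1 y (sigma / a y - 1)) ->
  (forall y, Rabs (X y) <= D) -> (forall y, Rabs (X1 y) <= D) ->
  smooth phi ->
  (forall k, (k <= 4)%nat -> forall x, Rabs (Derive_n phi k x) <= C) ->
  0 <= lam -> 0 < T ->
  (forall x t, 0 <= t <= T ->
    Rabs (walk_dt lam h N phi x t - sigma * walk lam h N (Derive_n phi 2) x t) <= eta) ->
  exists E, 0 <= E /\ forall eps u, 0 < eps <= 1 ->
    bounded_classical_solution (fun x => a (/ eps * x)) phi u ->
    forall x t, 0 <= t <= T -> Rabs (u x t - walk lam h N phi x t) <= eta * t + eps * E.
Proof.
  intros Ha dX dX1 bX bX1 Hphi bphi Hlam HT Hdef.
  assert (HC : 0 <= C) by (apply Rle_trans with (2 := bphi 0%nat ltac:(lia) 0), Rabs_pos).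
  assert (HD : 0 <= D) by (apply Rle_trans with (2 := bX 0), Rabs_pos).
  assert (HA : 0 < A) by (specialize (Ha 0); lra).
  pose (V := fun k => walk lam h N (Derive_n phi k)).
  assert (bV : forall k, (k <= 4)%nat -> forall x t, 0 <= t -> Rabs (V k x t) <= C).
  { intros k Hk x t Ht. unfold V. apply walk_bound; [nra |]. now apply bphi. }
  assert (dV : forall k x t, is_derive (fun y => V k y t) x (V (S k) x t)).
  { intros k x t. apply is_derive_walk_x. intros y. now apply smooth_is_derive. }
  assert (dtV : forall k x t, is_derive (fun s => V k x s) t
                  (walk_dt lam h N (Derive_n phi k) x t)).
  { intros k x t. apply is_derive_walk_t. }
  assert (cphi : forall k x, continuous (Derive_n phi k) x).
  { intros k x. apply (ex_derive_continuous (K := R_AbsRing) (V := R_NormedModule)).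
    exact (Hphi (S k) x). }
  (* The initial and pointwise errors are at most [eps * D * C] each; [F] bounds
     the part of the defect that carries a factor [eps]. *)
  pose (F := D * (3 * lam * C) + 3 * (A * (D * C))).
  assert (HDC : 0 <= D * C) by now apply Rmult_le_pos.
  assert (HF : 0 <= F).
  { unfold F. assert (0 <= D * (3 * lam * C)) by (repeat apply Rmult_le_pos; lra).
    assert (0 <= A * (D * C)) by (apply Rmult_le_pos; lra). lra. }
  exists (2 * (D * C) + F * T). split; [nra |].
  intros eps u Heps Hu.
  pose (W := fun x t => V 0%nat x t + eps ^ 2 * X (/ eps * x) * V 2%nat x t).
  assert (He2 : 0 <= eps ^ 2 <= eps) by (simpl; nra).
  assert (bXV : forall y k x t, (k <= 4)%nat -> 0 <= t ->
            Rabs (X y * V k x t) <= D * C /\ Rabs (X1 y * V k x t) <= D * C).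
  { intros y k x t Hk Ht. rewrite !Rabs_mult.
    split; apply Rmult_le_compat; auto using Rabs_pos. }
  assert (bW : forall x t, 0 <= t -> Rabs (W x t - V 0%nat x t) <= eps * (D * C)).
  { intros x t Ht. unfold W.
    replace (_ - _) with (eps ^ 2 * (X (/ eps * x) * V 2%nat x t)) by ring.
    rewrite Rabs_mult, (Rabs_pos_eq (eps ^ 2)) by lra.
    destruct (bXV (/ eps * x) 2%nat x t) as [Hb _]; [lia | trivial |].
    apply Rmult_le_compat; trivial; [lra | apply Rabs_pos | lra]. }
  assert (Hmain : forall x t, 0 <= t <= T ->
            Rabs (u x t - W x t) <= eps * (D * C) + (eta + eps * F) * t).
  { apply (approximate_solution_error (fun x => a (/ eps * x)) phi u W
      (fun x t => walk_dt lam h N (Derive_n phi 0) x t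
         + eps ^ 2 * X (/ eps * x) * walk_dt lam h N (Derive_n phi 2) x t)
      (fun x t => V 1%nat x t + eps * X1 (/ eps * x) * V 2%nat x t
         + eps ^ 2 * X (/ eps * x) * V 3%nat x t)
      (fun x t => V 2%nat x t + (sigma / a (/ eps * x) - 1) * V 2%nat x t
         + 2 * eps * X1 (/ eps * x) * V 3%nat x t
         + eps ^ 2 * X (/ eps * x) * V 4%nat x t)
      A T (C + eps * (D * C))); trivial.
    - intros x. specialize (Ha (/ eps * x)). lra.
    - intros p. unfold W. apply continuous_Rplus; [apply continuous_walk, cphi |].
      apply continuous_Rmult; [| apply continuous_walk, cphi].
      apply continuous_Rmult; [apply continuous_const |].
      apply (continuous_fst_comp (fun x => X (/ eps * x))).
      apply (continuous_comp (fun x => / eps * x) X).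
      + apply continuous_Rmult; [apply continuous_const | apply continuous_id].
      + apply (ex_derive_continuous (K := R_AbsRing) (V := R_NormedModule)).
        eexists; apply dX.
    - intros x t Ht. specialize (bW x t ltac:(lra)).
      specialize (bV 0%nat ltac:(lia) x t ltac:(lra)).
      apply Rabs_le_between in bV, bW. apply Rabs_le. lra.
    - intros x. specialize (bW x 0 ltac:(lra)). unfold V in bW at 1.
      rewrite walk_initial in bW. rewrite Rabs_minus_sym. exact bW.
    - intros x t _. unfold W.
      pose proof (dtV 0%nat x t) as d0. pose proof (dtV 2%nat x t) as d2.
      auto_derive.
      + split; [eexists; apply d0 |]. split; [eexists; apply d2 | easy].
      + rewrite (is_derive_unique (fun s : R => V 0%nat x s) _ _ d0).
        rewrite (is_derive_unique (fun s : R => V 2%nat x s) _ _ d2). ring.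
    - intros x t _. unfold W.
      pose proof (dV 0%nat x t) as d0. pose proof (dV 2%nat x t) as d2.
      pose proof (dX (/ eps * x)) as dx.
      auto_derive.
      + split; [eexists; apply d0 |]. split; [eexists; apply dx |].
        split; [eexists; apply d2 | easy].
      + rewrite (is_derive_unique (fun y : R => V 0%nat y t) _ _ d0).
        rewrite (is_derive_unique (fun y : R => V 2%nat y t) _ _ d2).
        rewrite (is_derive_unique (fun y : R => X y) _ _ dx). field. lra.
    - intros x t _.
      pose proof (dV 1%nat x t) as d1. pose proof (dV 2%nat x t) as d2.
      pose proof (dV 3%nat x t) as d3.
      pose proof (dX (/ eps * x)) as dx. pose proof (dX1 (/ eps * x)) as dx1.
      auto_derive.
      + repeat split; eexists; eassumption.
      + rewrite (is_derive_unique (fun y : R => V 1%nat y t) _ _ d1).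
        rewrite (is_derive_unique (fun y : R => V 2%nat y t) _ _ d2).
        rewrite (is_derive_unique (fun y : R => V 3%nat y t) _ _ d3).
        rewrite (is_derive_unique (fun y : R => X y) _ _ dx).
        rewrite (is_derive_unique (fun y : R => X1 y) _ _ dx1).
        field. specialize (Ha (/ eps * x)). lra.
    - intros x t Ht. specialize (Hdef x t ltac:(lra)).
      specialize (Ha (/ eps * x)).
      set (y := / eps * x) in *.
      pose (R1 := X y * walk_dt lam h N (Derive_n phi 2) x t).
      assert (B1 : Rabs R1 <= D * (3 * lam * C)).
      { unfold R1. rewrite Rabs_mult.
        apply Rmult_le_compat; auto using Rabs_pos.
        apply walk_dt_bound; [lra | lra |]. apply bphi. lia. }
      destruct (bXV y 3%nat x t) as [_ B2]; [lia | lra |].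
      destruct (bXV y 4%nat x t) as [B3 _]; [lia | lra |].
      (* The terms of order one cancel by the cell problem. *)
      change (walk_dt lam h N (Derive_n phi 0) x t) with (walk_dt lam h N phi x t).
      change (walk lam h N (Derive_n phi 2) x t) with (V 2%nat x t) in Hdef.
      replace (_ - _) with
        ((walk_dt lam h N phi x t - sigma * V 2%nat x t)
         + (eps ^ 2 * R1 - 2 * eps * (a y * (X1 y * V 3%nat x t))
            - eps ^ 2 * (a y * (X y * V 4%nat x t))))
        by (unfold R1; field; lra).
      assert (B2' : Rabs (a y * (X1 y * V 3%nat x t)) <= A * (D * C)).
      { rewrite Rabs_mult, (Rabs_pos_eq (a y)) by lra.
        apply Rmult_le_compat; trivial; [lra | apply Rabs_pos | lra]. }
      assert (B3' : Rabs (a y * (X y * V 4%nat x t)) <= A * (D * C)).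
      { rewrite Rabs_mult, (Rabs_pos_eq (a y)) by lra.
        apply Rmult_le_compat; trivial; [lra | apply Rabs_pos | lra]. }
      assert (P1 : Rabs (eps ^ 2 * R1) <= eps * (D * (3 * lam * C))).
      { rewrite Rabs_mult, (Rabs_pos_eq (eps ^ 2)) by lra.
        apply Rmult_le_compat; trivial; [lra | apply Rabs_pos | lra]. }
      assert (P2 : Rabs (eps * (a y * (X1 y * V 3%nat x t))) <= eps * (A * (D * C))).
      { rewrite Rabs_mult, (Rabs_pos_eq eps) by lra.
        apply Rmult_le_compat_l; [lra | trivial]. }
      assert (P3 : Rabs (eps ^ 2 * (a y * (X y * V 4%nat x t))) <= eps * (A * (D * C))).
      { rewrite Rabs_mult, (Rabs_pos_eq (eps ^ 2)) by lra.
        apply Rmult_le_compat; trivial; [lra | apply Rabs_pos | lra]. }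
      unfold F.
      apply Rabs_le_between in Hdef, P1, P2, P3. apply Rabs_le. lra. }
  intros x t Ht. specialize (Hmain x t Ht). specialize (bW x t ltac:(lra)).
  change (walk lam h N phi x t) with (V 0%nat x t).
  assert (eps * F * t <= eps * F * T).
  { apply Rmult_le_compat_l; [apply Rmult_le_pos; lra | lra]. }
  apply Rabs_le_between in Hmain, bW. apply Rabs_le. lra.
Qed.

(** Uniform closeness. The homogenized solution is itself compared with [walk]
    through [two_scale_error], with constant coefficient and zero corrector. *)
Lemma homogenization_uniform (a : R -> R) (l sigma : R) (phi : R -> R)
    (u : R -> R -> R -> R) (u0 : R -> R -> R) :
  0 < l -> periodic l a -> (forall x, continuous a x) -> (forall x, 0 < a x) ->
  sigma = / mean l (fun y => / a y) ->
  smooth phi -> compactly_supported phi ->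
  (forall eps, 0 < eps ->
     bounded_classical_solution (fun x => a (/ eps * x)) phi (u eps)) ->
  bounded_classical_solution (fun _ => sigma) phi u0 ->
  forall t delta, 0 <= t -> 0 < delta ->
    exists e, 0 < e /\ forall eps, 0 < eps < e ->
      forall x, Rabs (u eps x t - u0 x t) <= delta.
Proof.
  intros Hl Hp Hc Hpos Hs Hphi Hsupp Hu Hu0 t delta Ht Hdelta.
  assert (Hsig : 0 < sigma).
  { rewrite Hs. apply Rinv_0_lt_compat, mean_pos; trivial.
    - intros x. apply continuous_Rinv_comp; trivial. specialize (Hpos x). lra.
    - intros x. now apply Rinv_0_lt_compat. }
  destruct (periodic_bounded l a) as [A HA]; trivial.
  assert (HaA : forall y, 0 < a y <= A).
  { intros y. specialize (HA y). pose proof (Rle_abs (a y)). split; trivial. lra. }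
  destruct (corrector l a sigma) as (X & X1 & D & dX & dX1 & bX & bX1); trivial.
  destruct (test_function_derivatives_bounded phi 4) as [C bphi]; trivial.
  pose (T := t + 1). assert (HT : 0 < T) by (unfold T; lra).
  pose (eta := delta / (8 * T)).
  assert (Heta : 0 < eta) by (apply Rdiv_lt_0_compat; lra).
  assert (HetaT : eta * t <= delta / 8).
  { apply Rle_trans with (eta * T); [apply Rmult_le_compat_l; unfold T; lra |].
    right. unfold eta. field. lra. }
  destruct (walk_defect sigma T eta C phi (Derive_n phi 1) (Derive_n phi 2)
              (Derive_n phi 3)) as (lam & h & N & Hlam & Hdef); trivial.
  { exact (fun x => smooth_is_derive phi 0 Hphi x). }
  { exact (fun x => smooth_is_derive phi 1 Hphi x). }
  { exact (fun x => smooth_is_derive phi 2 Hphi x). }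
  { exact (bphi 0%nat ltac:(lia)). }
  { exact (bphi 3%nat ltac:(lia)). }
  destruct (two_scale_error a X X1 sigma A D phi C lam h N T eta) as (E & HE & HuE);
    trivial.
  (* For a constant coefficient the equation does not involve [eps], so the
     estimate holds for [u0] with the same [eps] as for [u eps]. *)
  destruct (two_scale_error (fun _ => sigma) (fun _ => 0) (fun _ => 0) sigma sigma 0
              phi C lam h N T eta) as (E0 & HE0 & Hu0E); trivial.
  { intros _. lra. }
  { intros y. apply (is_derive_const (V := R_NormedModule) 0). }
  { intros y. replace (sigma / sigma - 1) with 0 by (field; lra).
    apply (is_derive_const (V := R_NormedModule) 0). }
  { intros _. rewrite Rabs_R0. lra. }
  { intros _. rewrite Rabs_R0. lra. }
  assert (Hpick : 0 < delta / (8 * (E + E0 + 1))) by (apply Rdiv_lt_0_compat; lra).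
  pose (e := Rmin 1 (delta / (8 * (E + E0 + 1)))).
  assert (He : 0 < e) by (apply Rmin_glb_lt; lra).
  exists e. split; trivial. intros eps Heps x.
  assert (He1 : e <= 1) by apply Rmin_l.
  assert (He2 : eps * (E + E0) <= delta / 8).
  { apply Rle_trans with (delta / (8 * (E + E0 + 1)) * (E + E0 + 1)).
    - apply Rmult_le_compat; try lra.
      apply Rle_trans with e; [lra | apply Rmin_r].
    - right. field. lra. }
  pose proof (HuE eps (u eps) ltac:(lra) (Hu eps ltac:(lra)) x t ltac:(unfold T; lra)) as G1.
  pose proof (Hu0E eps u0 ltac:(lra) Hu0 x t ltac:(unfold T; lra)) as G2.
  assert (0 <= eps * E) by (apply Rmult_le_pos; lra).
  assert (0 <= eps * E0) by (apply Rmult_le_pos; lra).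
  apply Rabs_le_between in G1, G2. apply Rabs_le. lra.
Qed.

Theorem mainTheorem7
  (g : R -> R) (l : R) (hl : 0 < l) (g_smooth : smooth g) (g_per : periodic l g)
  (mu : R) (mu_pos : forall y, 0 < 1 + mu * g y)
  (phi : R -> R) (phi_smooth : smooth phi) (phi_supp : compactly_supported phi)
  (u : R -> R -> R -> R)
  (u_sol : forall eps, 0 < eps ->
     bounded_classical_solution (fun x => 1 + mu * g (/ eps * x)) phi (u eps))
  (sigma : R) (sigma_def : sigma = / mean l (fun y => / (1 + mu * g y)))
  (u0 : R -> R -> R)
  (u0_sol : bounded_classical_solution (fun _ => sigma) phi u0) :
  forall t, 0 <= t ->
    exists S : R -> R,
      (forall eps, 0 < eps ->
         is_lub (fun r => exists x, r = Rabs (u eps x t - u0 x t)) (S eps)) /\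
      filterlim S (at_right 0) (locally 0).
Proof.
  intros t Ht.
  pose (Err := fun eps r => exists x, r = Rabs (u eps x t - u0 x t)).
  assert (Hlub : forall eps, 0 < eps -> exists s, is_lub (Err eps) s).
  { intros eps Heps.
    destruct (bcs_bounded _ _ _ (u_sol eps Heps) (t + 1) ltac:(lra)) as [M HM].
    destruct (bcs_bounded _ _ _ u0_sol (t + 1) ltac:(lra)) as [M0 HM0].
    destruct (completeness (Err eps)) as [s Hs].
    - exists (M + M0). intros r [x ->].
      specialize (HM x t ltac:(lra)). specialize (HM0 x t ltac:(lra)).
      apply Rabs_le_between in HM, HM0. apply Rabs_le. lra.
    - exists (Rabs (u eps 0 t - u0 0 t)). now exists 0.
    - now exists s. }
  (* Only the values at [eps > 0] matter. *)
  pose (S := fun eps => epsilon (inhabits 0) (is_lub (Err eps))).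
  assert (HS : forall eps, 0 < eps -> is_lub (Err eps) (S eps)).
  { intros eps Heps. apply epsilon_spec. auto. }
  exists S. split; [exact HS |].
  apply filterlim_locally. intros d.
  destruct (homogenization_uniform (fun y => 1 + mu * g y) l sigma phi u u0)
    with (t := t) (delta := d / 2) as (e & He & Hu); trivial.
  { intros y. now rewrite g_per. }
  { intros y. apply continuous_Rplus; [apply continuous_const |].
    apply continuous_Rmult; [apply continuous_const | now apply smooth_continuous]. }
  { pose proof (cond_pos d). lra. }
  exists (mkposreal e He). intros eps Hb Heps. simpl in Hb.
  change (Rabs (eps - 0) < e) in Hb. rewrite Rminus_0_r, Rabs_pos_eq in Hb by lra.
  destruct (HS eps Heps) as [Hub Hleast].
  assert (S eps <= d / 2).
  { apply Hleast. intros r [x ->]. apply Hu. lra. }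
  assert (0 <= S eps).
  { apply Rle_trans with (Rabs (u eps 0 t - u0 0 t)); [apply Rabs_pos |].
    apply Hub. now exists 0. }
  change (Rabs (S eps - 0) < d). rewrite Rminus_0_r, Rabs_pos_eq by lra.
  pose proof (cond_pos d). lra.
Qed.
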